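(* Let $N=pd$ with $p,d$ positive integers, let $q_1,\dots,q_K$ be all the positive divisors of $N$, and suppose that $\mathcal R_{p,N}$ is a tight frame for $\ell^2(\mathbb Z_N)$ with bound $A$. Let $x\in\ell^2(\mathbb Z_N)$ be nonzero, with representations $$x=\sum_{n=0}^{N-1}\alpha_ne_n=\frac1A\sum_{i=1}^K\sum_{m=0}^{d-1}(x*c_{q_i})(pm)\,L_{pm}c_{q_i}$$ with respect to the canonical basis $\{e_n\}_{n\in\mathbb Z_N}$ and the tight frame $\mathcal R_{p,N}$. Let $$S_x=\#\{(k,i)\in\{0,\dots,d-1\}\times\{1,\dots,K\}:(x*c_{q_i})(pk)\ne0\},\qquad B_x=\#\{n\in\{0,\dots,N-1\}:\alpha_n\ne0\}.$$ Then $$S_x+B_x\ge\frac{2d\sqrt p}{\phi(N)}\qquad\text{and}\qquad S_xB_x\ge p\left(\frac{d}{\phi(N)}\right)^2.$$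
   Context: $\ell^2(\mathbb Z_N)$ is the $N$-dimensional complex Hilbert space of functions on $\mathbb Z_N=\{0,1,\dots,N-1\}$ (identified with $N$-periodic functions on $\mathbb Z$), with $\langle x,y\rangle=\sum_{n=0}^{N-1}x(n)\overline{y(n)}$. For $m\in\mathbb Z$, the circular shift is $L_mx(n)=x(n-m)$. For a positive integer $q$, the $q$-th Ramanujan sum is $c_q(n)=\sum_{1\le k\le q,\,(k,q)=1}e^{2\pi i kn/q}$; it is $q$-periodic, so for $q\mid N$ it is regarded as an element of $\ell^2(\mathbb Z_N)$. $\phi$ is Euler's totient function. The circular convolution is $(x*y)(n)=\sum_{m=0}^{N-1}x(m)y(n-m)$. $\mathcal R_{p,N}$ denotes the family $(L_{pk}c_{q_i})$ indexed by $(k,i)\in\{0,\dots,d-1\}\times\{1,\dots,K\}$. A finite family $(f_j)$ is a tight frame for $\ell^2(\mathbb Z_N)$ with bound $A>0$ if $\sum_j|\langle x,f_j\rangle|^2=A\|x\|^2$ for all $x\in\ell^2(\mathbb Z_N)$. *)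

(* Defs.v *)
From HB Require Import structures.
From mathcomp Require Export all_boot all_order all_algebra.
From mathcomp Require Export complex.
From mathcomp Require Export reals trigo.

Set Implicit Arguments.
Unset Strict Implicit.
Unset Printing Implicit Defensive.

Import Order.TTheory GRing.Theory Num.Theory.

Local Open Scope ring_scope.

Notation ell2 R N := {ffun 'I_N -> R[i]}.

Section Defs.
Variable R : realType.

(* For 0 < N the reduced index is always in 'I_N, so the default value 0 is
   only reached in the degenerate case N = 0. *)
Definition periodic (N : nat) (x : ell2 R N) (n : int) : R[i] :=
  oapp x 0 (insub `|(n %% N%:Z)%Z|%N).

Definition inner (N : nat) (x y : ell2 R N) : R[i] :=
  \sum_(n < N) x n * (y n)^*.

Definition l2norm (N : nat) (x : ell2 R N) : R[i] := sqrtC (inner x x).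

Definition basis_vec (N : nat) (n : 'I_N) : ell2 R N :=
  [ffun m => (m == n)%:R].

Definition shift (N : nat) (m : int) (x : ell2 R N) : ell2 R N :=
  [ffun n : 'I_N => periodic x ((n : nat)%:Z - m)].

Definition conv (N : nat) (x y : ell2 R N) : ell2 R N :=
  [ffun n : 'I_N =>
     \sum_(m < N) x m * periodic y ((n : nat)%:Z - (m : nat)%:Z)].

Definition expi (t : R) : R[i] := (cos t +i* sin t)%C.

Definition ramanujan_sum (q : nat) (n : int) : R[i] :=
  \sum_(1 <= k < q.+1 | coprime k q) expi (2 * pi * k%:R * n%:~R / q%:R).

Definition ramanujan (N q : nat) : ell2 R N :=
  [ffun n : 'I_N => ramanujan_sum q (n : nat)%:Z].

Definition tight_frame (N : nat) (J : finType) (f : J -> ell2 R N) (A : R) :=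
  0 < A /\
  forall x : ell2 R N,
    \sum_(j : J) `|inner x (f j)| ^+ 2 = A%:C%C * l2norm x ^+ 2.

Definition ramanujan_family (N p d K : nat) (q : 'I_K -> nat)
    (j : 'I_d * 'I_K) : ell2 R N :=
  shift (p * j.1)%:Z (ramanujan N (q j.2)).

End Defs.

(* Main.v *)
(* Every coefficient is an inner product, <x, L_{pk} c_q> = (x * c_q)(pk), and
   |c_q| <= phi(q) <= phi(N).  Cauchy-Schwarz on the support of x then bounds
   each squared coefficient by phi(N)^2 B_x ||x||^2; summing over the S_x
   nonzero ones, A ||x||^2 <= S_x B_x phi(N)^2 ||x||^2.  Testing the frame on
   the constant vector, which is orthogonal to every shift of c_q unless q = 1,
   gives A = d N = p d^2.  The bound on the sum is AM-GM. *)
Require Import Defs.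
From mathcomp Require Import ring lra.

Set Implicit Arguments.
Unset Strict Implicit.
Unset Printing Implicit Defensive.

Import Order.TTheory GRing.Theory Num.Theory.
Local Open Scope ring_scope.

(** * Monotonicity of the totient under divisibility, and a finite Cauchy-Schwarz inequality *)

Lemma totient_dvdn_leq (m n : nat) :
  (0 < n)%N -> (m %| n)%N -> (totient m <= totient n)%N.
Proof.
move=> n0 mn; have m0 := dvdn_gt0 n0 mn.
have sub : {subset primes m <= primes n}.
  move=> r; rewrite !mem_primes => /and3P[-> _ rm] /=.
  by rewrite n0 (dvdn_trans rm mn).
rewrite !totientE // [leqRHS](bigID (mem (primes m))) /=.
rewrite -[X in (_ <= X * _)%N]big_filter.
have -> : \big[muln/1%N]_(r <- [seq r <- primes n | r \in primes m])
    (r.-1 * r ^ (logn r n).-1)%N =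
  (\prod_(r <- primes m) (r.-1 * r ^ (logn r n).-1))%N.
  apply: perm_big; apply: uniq_perm; rewrite ?filter_uniq ?primes_uniq //.
  by move=> r; rewrite mem_filter; case: (boolP (r \in primes m)) => //= /sub ->.
(* In Euler's product, a prime of [m] contributes a factor that grows with its exponent, and each
   remaining prime of [n] contributes a factor at least 1. *)
rewrite -[leqLHS]muln1 leq_mul //.
  rewrite big_seq [leqRHS]big_seq; apply: leq_prod => r.
  rewrite mem_primes => /and3P[rp _ _].
  rewrite leq_mul // leq_pexp2l ?prime_gt0 // -!subn1 leq_sub2r //.
  exact: dvdn_leq_log.
rewrite big_seq_cond; apply: prodn_cond_gt0 => r /andP[].
rewrite mem_primes => /and3P[rp _ _] _.
rewrite muln_gt0 expn_gt0 (prime_gt0 rp) andbT.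
by case: r rp => [|[|]].
Qed.

(** Cauchy-Schwarz against the constant 1: symmetrized, the right side is the double sum of
    [(r i ^+ 2 + r j ^+ 2) / 2], which dominates [r i * r j] term by term. *)
Lemma sqr_sum_le (F : numFieldType) (I : finType) (P : pred I) (r : I -> F) :
  (forall i, r i \is Num.real) ->
  (\sum_(i | P i) r i) ^+ 2 <= #|P|%:R * \sum_(i | P i) r i ^+ 2.
Proof.
move=> rr; rewrite expr2 mulr_suml.
have -> : #|P|%:R * \sum_(i | P i) r i ^+ 2 =
    \sum_(i | P i) \sum_(j | P j) (r i ^+ 2 + r j ^+ 2) / 2.
  rewrite [RHS](eq_bigr (fun i => r i ^+ 2 / 2 *+ #|P| +
      \sum_(j | P j) r j ^+ 2 / 2)).
    rewrite big_split /= sumr_const sumrMnl -mulrnDl -mulr_suml -splitr.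
    by rewrite mulr_natl.
  move=> i _; under eq_bigr do rewrite mulrDl.
  by rewrite big_split /= sumr_const.
apply: ler_sum => i _; rewrite mulr_sumr; apply: ler_sum => j _.
by have [] := real_leif_mean_square (rr i) (rr j).
Qed.

(** * The complex exponential on the unit circle *)

Section Expi.
Variable R : realType.
Implicit Types t u : R.

Lemma expi0 : expi (0 : R) = 1.
Proof. by rewrite /expi cos0 sin0. Qed.

Lemma expiD t u : expi (t + u) = expi t * expi u.
Proof. by rewrite /expi cosD sinD; simpc; rewrite [sin t * _ + _]addrC. Qed.

Lemma conj_expi t : (expi t)^* = expi (- t).
Proof. by rewrite /expi cosN sinN. Qed.

Lemma norm_expi t : `|expi t| = 1.
Proof. by rewrite normc_def /= cos2Dsin2 sqrtr1. Qed.

Lemma expiMn t n : expi (t *+ n) = expi t ^+ n.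
Proof. by elim: n => [|n IH]; rewrite ?expi0 // mulrS expiD IH exprS. Qed.

Lemma expi_2pi_int (z : int) : expi (2 * pi * z%:~R : R) = 1.
Proof.
have H n : expi (2 * pi * n%:R : R) = 1.
  rewrite mulr_natr expiMn /expi mulrC mulr_natr cos2pi sin2pi.
  exact: expr1n.
case: z => n; first exact: H.
by rewrite NegzE mulrNz mulrN -conj_expi H conjC1.
Qed.

(** Half-angle formula: [cos t] is 1 minus twice the square of [sin (t / 2)], and this sine is
    positive on the given range. *)
Lemma expi_neq1 t : 0 < t < 2 * pi -> expi t != 1.
Proof.
move=> /andP[t0 t2]; apply/eqP => -[ct _].
have sp : 0 < sin (t / 2) by apply: sin_gt0_pi; apply/andP; split; lra.
have := cos_mulr2n (t / 2); rewrite -[t / 2 *+ 2]mulr_natr divfK ?pnatr_eq0 //.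
rewrite ct; have := cos2Dsin2 (t / 2).
have : 0 < sin (t / 2) ^+ 2 by rewrite exprn_gt0.
rewrite -mulr_natr; lra.
Qed.

End Expi.

(** * Ramanujan sums: symmetry, periodicity, size and mean over a period *)

Section RamanujanSum.
Variable R : realType.

Lemma conj_ramanujan_sum q (n : int) :
  (ramanujan_sum R q n)^* = ramanujan_sum R q (- n).
Proof.
rewrite rmorph_sum; apply: eq_bigr => k _ /=; rewrite conj_expi.
by rewrite mulrNz mulrN mulNr.
Qed.

Lemma ramanujan_sum_periodic q (m n : int) : (0 < q)%N ->
  ramanujan_sum R q (m * q%:Z + n) = ramanujan_sum R q n.
Proof.
move=> q0; apply: eq_bigr => k _.
rewrite -[RHS]mul1r -(expi_2pi_int R (k%:Z * m)) -expiD; congr expi.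
have : (q%:R : R) != 0 by rewrite pnatr_eq0 -lt0n.
rewrite !(rmorphD, rmorphM) /= -!pmulrn => H; by field.
Qed.

Lemma norm_ramanujan_sum_le q (n : int) : (0 < q)%N ->
  `|ramanujan_sum R q n| <= (totient q)%:R.
Proof.
move=> q0; apply: le_trans (ler_norm_sum _ _ _) _.
under eq_bigr do rewrite norm_expi.
rewrite totient_count_coprime (big_ltn q0) natrD.
(* The totient counts residues from 0 to q - 1, the Ramanujan sum those from 1 to q; the end terms 0
   and q have the same gcd with q. *)
have -> : coprime q 0 = coprime q q by rewrite /coprime gcdn0 gcdnn.
rewrite natr_sum big_mkcond /= big_nat_recr //= addrC -mulrb lerD //.
by apply: ler_sum => k _; rewrite -mulrb coprime_sym.
Qed.

(** After exchanging the sums, each k gives a geometric series in a primitive q-th root of unity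
    [z]. For q > 1 this root differs from 1 while [z ^+ N = 1], so the series vanishes. *)
Lemma sum_ramanujan_sum N q (a : int) : (0 < N)%N -> (q %| N)%N ->
  \sum_(n < N) ramanujan_sum R q (n%:Z + a) = ((q == 1%N) * N)%:R.
Proof.
move=> N0 qN; have q0 := dvdn_gt0 N0 qN.
have q0R : (q%:R : R) != 0 by rewrite pnatr_eq0 -lt0n.
rewrite exchange_big /=.
have [->|q1] := eqVneq q 1%N.
  rewrite big_ltn_cond // coprimen1 big_geq // addr0.
  rewrite mul1n -[in RHS](card_ord N) -sumr_const; apply: eq_bigr => n _.
  by rewrite divr1 mulr1 expi_2pi_int.
rewrite mul0n big_nat_cond big1 // => k /andP[/andP[k1 kq] kcop].
(* The endpoint k = q is coprime to q only when q = 1; excluding it keeps the angle strictly below a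
   full turn. *)
have {}kq : (k < q)%N.
  rewrite ltn_neqAle -ltnS kq andbT; apply: contraNneq q1 => kq'.
  by move: kcop; rewrite kq' /coprime gcdnn.
pose z := expi (2 * pi * k%:R / q%:R : R).
have zn (n : nat) : z ^+ n = expi (2 * pi * k%:R * n%:R / q%:R : R).
  by rewrite -expiMn -mulr_natr; congr expi; ring.
have zna (n : nat) : expi (2 * pi * k%:R * (n%:Z + a)%:~R / q%:R : R) =
    z ^+ n * expi (2 * pi * k%:R * a%:~R / q%:R).
  by rewrite zn -expiD rmorphD /= -pmulrn; congr expi; ring.
under eq_bigr do rewrite zna.
rewrite -mulr_suml; apply/eqP; rewrite mulf_eq0; apply/orP; left; apply/eqP.
have z1 : z - 1 != 0.
  rewrite subr_eq0; apply: expi_neq1.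
  have p0 := pi_gt0 R; have qp : 0 < (q%:R : R) by rewrite ltr0n.
  rewrite !divr_gt0 ?mulr_gt0 ?ltr0n //= ltr_pdivrMr // ltr_pM2l ?ltr_nat //.
  by rewrite mulr_gt0.
apply: (mulfI z1); rewrite -subrX1 mulr0 zn.
case/dvdnP: qN => m ->; apply/eqP; rewrite subr_eq0; apply/eqP.
rewrite -[RHS](expi_2pi_int R (k%:Z * m%:Z)); congr expi.
rewrite natrM rmorphM /= -!pmulrn; by field.
Qed.

End RamanujanSum.

(** * Inner products, tight frames and the general uncertainty bound *)

Section Ell2.
Variables (R : realType) (N : nat).
Implicit Types x y : ell2 R N.

Lemma innerDl x1 x2 y : inner (x1 + x2) y = inner x1 y + inner x2 y.
Proof. by rewrite -big_split; apply: eq_bigr => n _; rewrite ffunE mulrDl. Qed.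

Lemma innerZl c x y : inner (c *: x) y = c * inner x y.
Proof. by rewrite mulr_sumr; apply: eq_bigr => n _; rewrite ffunE -mulrA. Qed.

Lemma conj_inner x y : (inner x y)^* = inner y x.
Proof.
rewrite rmorph_sum; apply: eq_bigr => n _.
by rewrite rmorphM /= conjCK mulrC.
Qed.

Lemma inner_basis_vec x n : inner x (basis_vec R n) = x n.
Proof.
rewrite /inner (bigD1 n) //= big1 ?addr0 => [|m mn]; rewrite ffunE.
  by rewrite eqxx conjC1 mulr1.
by rewrite (negPf mn) conjC0 mulr0.
Qed.

Lemma sqr_l2norm x : l2norm x ^+ 2 = \sum_(n < N) `|x n| ^+ 2.
Proof. by rewrite sqrtCK; apply: eq_bigr => n _; rewrite normCK. Qed.

(* Polarization: the difference [G] of the two sides is a sesquilinear form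
   vanishing on the diagonal. *)
Lemma tight_frame_parseval (J : finType) (f : J -> ell2 R N) A x y :
  tight_frame f A ->
  \sum_j inner x (f j) * (inner y (f j))^* = A%:C%C * inner x y.
Proof.
case=> _ fr.
pose G u v := \sum_j inner u (f j) * (inner v (f j))^* - A%:C%C * inner u v.
have G0 u : G u u = 0.
  apply/eqP; rewrite subr_eq0; apply/eqP; rewrite -[inner u u]sqrtCK -fr.
  by apply: eq_bigr => j _; rewrite normCK.
have GDl u1 u2 v : G (u1 + u2) v = G u1 v + G u2 v.
  rewrite /G innerDl mulrDr opprD addrACA -big_split; congr (_ + _).
  by apply: eq_bigr => j _; rewrite innerDl mulrDl.
have GZl c u v : G (c *: u) v = c * G u v.
  rewrite /G innerZl mulrBr mulrCA; congr (_ - _); rewrite mulr_sumr.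
  by apply: eq_bigr => j _; rewrite innerZl mulrA.
have GC u v : (G u v)^* = G v u.
  rewrite /G rmorphB rmorphM /= conj_inner rmorph_sum; congr (_ - _ * _).
    by apply: eq_bigr => j _; rewrite rmorphM /= conjCK mulrC.
  exact: conjc_real.
have GDr u v1 v2 : G u (v1 + v2) = G u v1 + G u v2.
  by rewrite -GC GDl rmorphD /= !GC.
have GZr c u v : G u (c *: v) = c^* * G u v.
  by rewrite -GC GZl rmorphM /= !GC.
(* The diagonal at [x + y] gives the sum of the two cross terms, and at [x + 'i *: y] their
   difference; both vanish, hence so does [G x y]. *)
have H1 : G x y + G y x = 0.
  by have := G0 (x + y); rewrite GDl !GDr !G0 add0r addr0.
have H2 : 'i * (G y x - G x y) = 0.
  have := G0 (x + 'i *: y).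
  by rewrite GDl !GDr !GZl !GZr !G0 conjCi !mulr0 add0r addr0 => <-; ring.
move/eqP: H2; rewrite mulf_eq0 (negPf (neq0Ci _)) /= subr_eq0 => /eqP H2.
by move/eqP: H1; rewrite H2 -mulr2n mulrn_eq0 /= subr_eq0 => /eqP.
Qed.

(** Parseval's identity with a canonical basis vector as second argument reads off one coordinate of
    the expansion. *)
Lemma tight_frame_reconstruction (J : finType) (f : J -> ell2 R N) A x :
  tight_frame f A ->
  x = (A^-1)%:C%C *: \sum_j inner x (f j) *: f j.
Proof.
move=> fr; have A0 : A%:C%C != 0 :> R[i].
  by case: fr => A0 _; rewrite fmorph_eq0 gt_eqF.
apply/ffunP => n; rewrite ffunE sum_ffunE.
rewrite -[x n]inner_basis_vec; apply: (mulfI A0).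
rewrite -(tight_frame_parseval _ _ fr) fmorphV mulrA divff // mul1r.
apply: eq_bigr => j _; rewrite ffunE.
by rewrite conj_inner inner_basis_vec.
Qed.

Lemma periodic_ord x (n : 'I_N) : periodic x (n : nat)%:Z = x n.
Proof.
by rewrite /periodic modz_small ?lez_nat ?ltz_nat //= valK.
Qed.

Lemma periodic_ramanujan q (a : int) : (0 < N)%N -> (q %| N)%N ->
  periodic (ramanujan R N q) a = ramanujan_sum R q a.
Proof.
move=> N0 qN; have N0' : (N%:Z != 0) by rewrite -lt0n.
have aN : (`|(a %% N%:Z)%Z|%N < N)%N.
  by rewrite -ltz_nat gez0_abs ?modz_ge0 // ltz_pmod.
rewrite /periodic insubT /= ffunE /= gez0_abs ?modz_ge0 //.
rewrite [in RHS](divz_eq a N%:Z); case/dvdnP: qN (dvdn_gt0 N0 qN) => m -> q0.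
by rewrite PoszM [in RHS]mulrA ramanujan_sum_periodic.
Qed.

(** Conjugating a Ramanujan sum reflects its argument, which turns the inner product with a shift
    into a convolution sum. *)
Lemma inner_shift_ramanujan x q (m : int) : (0 < N)%N -> (q %| N)%N ->
  inner x (shift m (ramanujan R N q)) =
  \sum_(n < N) x n * ramanujan_sum R q (m - n%:Z).
Proof.
move=> N0 qN; apply: eq_bigr => n _.
by rewrite ffunE periodic_ramanujan // conj_ramanujan_sum opprB.
Qed.

Lemma periodic_conv_ramanujan x q (m : nat) : (m < N)%N -> (q %| N)%N ->
  periodic (conv x (ramanujan R N q)) m%:Z =
  inner x (shift m%:Z (ramanujan R N q)).
Proof.
move=> mN qN; have N0 : (0 < N)%N by apply: leq_ltn_trans mN.
rewrite inner_shift_ramanujan // (periodic_ord _ (Ordinal mN)) ffunE.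
by apply: eq_bigr => n _; rewrite periodic_ramanujan.
Qed.

(** Only a uniform bound [M] on the entries of the frame vectors enters; for the Ramanujan family it
    will be the totient of N. *)
Lemma tight_frame_uncertainty (J : finType) (f : J -> ell2 R N) (A M : R) x :
  tight_frame f A -> (forall j n, `|f j n| <= M%:C%C) -> x != 0 ->
  A <= (#|[set j | inner x (f j) != 0]| * #|[set n | x n != 0]|)%:R * M ^+ 2.
Proof.
move=> [_ fr] fM x0.
have x2 : 0 < \sum_n `|x n| ^+ 2.
  rewrite lt0r sumr_ge0 ?andbT => [|n _]; last exact: exprn_ge0.
  apply: contra x0; rewrite psumr_eq0 => [/allP xn0|n _]; last exact: exprn_ge0.
  apply/eqP/ffunP => n; rewrite ffunE; apply/eqP.
  by have := xn0 n (mem_index_enum _); rewrite expf_eq0 normr_eq0.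
rewrite -lecR -(ler_pM2r x2) -sqr_l2norm -fr sqr_l2norm.
rewrite (bigID (fun j => inner x (f j) != 0)) /= [X in _ + X]big1; last first.
  by move=> j; rewrite negbK => /eqP ->; rewrite normr0 expr0n.
rewrite addr0 rmorphM natrM rmorphM rmorphXn /= !rmorph_nat -!mulrA mulr_natl.
rewrite -sumr_const [leRHS](eq_bigl (fun j => inner x (f j) != 0)); last first.
  by move=> j; rewrite inE.
apply: ler_sum => j _.
(* Restricting the sum to the support of [x] is what makes the support size appear when [sqr_sum_le]
   is applied. *)
have cj : `|inner x (f j)| <= (\sum_(n | x n != 0) `|x n|) * M%:C%C.
  apply: le_trans (ler_norm_sum _ _ _) _.
  rewrite (bigID (fun n => x n != 0)) /= [X in _ + X]big1; last first.
    by move=> n; rewrite negbK => /eqP ->; rewrite mul0r normr0.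
  rewrite addr0 mulr_suml; apply: ler_sum => n _.
  by rewrite normrM norm_conjC ler_wpM2l.
apply: (le_trans (lerXn2r 2 _ _ cj)); rewrite ?nnegrE //.
  exact: le_trans (normr_ge0 _) cj.
rewrite exprMn.
have -> : forall a b c : R[i], a * (c * (c * b)) = a * b * c ^+ 2.
  by move=> *; ring.
apply: ler_wpM2r; first by rewrite -rmorphXn ler0c sqr_ge0.
apply: le_trans (sqr_sum_le _ (fun n => normr_real (x n))) _.
rewrite cardsE ler_wpM2l // [leRHS](bigID (fun n => x n != 0)) /= lerDl.
by apply: sumr_ge0 => n _; apply: exprn_ge0.
Qed.

End Ell2.

(** * The Ramanujan frame: value of its bound, and the two estimates *)

Lemma ramanujan_tight_frame_bound (R : realType) (N p d K : nat)
    (q : 'I_K -> nat) (A : R) :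
  (0 < N)%N -> injective q ->
  (forall m, (exists i, q i = m) <-> (m %| N)%N) ->
  tight_frame (@ramanujan_family R N p d K q) A -> A = (d * N)%:R.
Proof.
move=> N0 qinj hq [_ fr].
have qN i : (q i %| N)%N by apply/hq; exists i.
have [i0 qi0] : exists i, q i = 1%N by apply/hq/dvd1n.
have N0C : (N%:R : R[i]) != 0 by rewrite pnatr_eq0 -lt0n.
pose e : ell2 R N := [ffun=> 1].
have inner_e (j : 'I_d * 'I_K) :
    inner e (ramanujan_family R N p q j) = ((j.2 == i0) * N)%:R.
  rewrite -conj_inner -[RHS]conjC_nat; congr (_^*).
  rewrite -(inj_eq qinj) qi0 -(sum_ramanujan_sum R (- (p * j.1)%:Z)) //.
  apply: eq_bigr => n _; rewrite !ffunE conjC1 mulr1.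
  by rewrite periodic_ramanujan.
have := fr e; rewrite sqr_l2norm.
under [in RHS]eq_bigr do rewrite ffunE normr1 expr1n.
rewrite (eq_bigr (fun j => ((j.2 == i0) * N)%:R ^+ 2)) => [|j _]; last first.
  by rewrite inner_e normr_nat.
(* Injectivity of [q] leaves [i0] as the only index with divisor 1, so exactly d family members
   contribute, each N squared; the frame identity becomes d N^2 = A N. *)
rewrite sumr_const card_ord.
rewrite -(pair_bigA _ (fun (_ : 'I_d) i => ((i == i0) * N)%:R ^+ 2)) /=.
under eq_bigr do [rewrite (bigD1 i0) //= eqxx mul1n big1 ?addr0; last
  by move=> i /negPf ->; rewrite mul0n expr0n].
rewrite sumr_const card_ord -[_ *+ d]mulr_natr => H.
apply: (fmorph_inj (real_complex R)); apply: (mulIf N0C).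
by rewrite -H /= rmorph_nat natrM; ring.
Qed.

Theorem theorem3p4 (R : realType) (N p d : nat)
    (hp : (0 < p)%N) (hd : (0 < d)%N) (hN : N = (p * d)%N)
    (K : nat) (q : 'I_K -> nat) (hqinj : injective q)
    (hq : forall m : nat, (exists i : 'I_K, q i = m) <-> (m %| N)%N)
    (A : R) (hA : tight_frame (@ramanujan_family R N p d K q) A)
    (x : ell2 R N) (hx : x != 0)
    (alpha : 'I_N -> R[i])
    (halpha : x = \sum_(n < N) alpha n *: basis_vec R n) :
  let coef (k : 'I_d) (i : 'I_K) : R[i] :=
    periodic (conv x (ramanujan R N (q i))) (p * k)%:Z in
  let S : nat := #|[set ki : 'I_d * 'I_K | coef ki.1 ki.2 != 0]| in
  let B : nat := #|[set n : 'I_N | alpha n != 0]| in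
  [/\ x = (A^-1)%:C%C *:
        (\sum_(i < K) \sum_(m < d)
           coef m i *: shift (p * m)%:Z (ramanujan R N (q i))),
      (S + B)%:R >= 2 * d%:R * Num.sqrt p%:R / (totient N)%:R :> R
    & (S * B)%:R >= p%:R * (d%:R / (totient N)%:R) ^+ 2 :> R].
Proof.
move=> coef S B.
have N0 : (0 < N)%N by rewrite hN muln_gt0 hp.
have qN i : (q i %| N)%N by apply/hq; exists i.
have coefE k i : coef k i = inner x (ramanujan_family R N p q (k, i)).
  (* Since k < d, the sample point p k lies below N and needs no reduction. *)
  by apply: periodic_conv_ramanujan; rewrite // hN ltn_pmul2l.
have alphaE n : alpha n = x n.
  rewrite halpha sum_ffunE (bigD1 n) //= !ffunE eqxx big1 => [|m mn].
    by rewrite addr0; apply/esym/mulr1.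
  by rewrite !ffunE eq_sym (negPf mn); apply: mulr0.
have phi0 : 0 < ((totient N)%:R : R) by rewrite ltr0n totient_gt0.
have SB : p%:R * (d%:R / (totient N)%:R) ^+ 2 <= (S * B)%:R :> R.
  rewrite expr_div_n mulrA ler_pdivrMr ?exprn_gt0 //.
  have -> : p%:R * d%:R ^+ 2 = A.
    rewrite (ramanujan_tight_frame_bound N0 hqinj hq hA) hN.
    by rewrite -natrX -natrM mulnCA mulnn.
  have -> : S = #|[set j : 'I_d * 'I_K |
                   inner x (ramanujan_family R N p q j) != 0]|.
    by congr #|pred_of_set _|; apply/setP => -[k i]; rewrite !inE coefE.
  have -> : B = #|[set n | x n != 0]|.
    by congr #|pred_of_set _|; apply/setP => n; rewrite !inE alphaE.
  apply: tight_frame_uncertainty => // j n.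
  rewrite ffunE periodic_ramanujan // rmorph_nat.
  apply: le_trans (norm_ramanujan_sum_le _ _ (dvdn_gt0 N0 (qN _))) _.
  by rewrite ler_nat totient_dvdn_leq.
split=> //.
  rewrite [LHS](tight_frame_reconstruction x hA) exchange_big /=.
  congr (_ *: _).
  rewrite pair_bigA; apply: eq_bigr => -[k i] _.
  by rewrite coefE.
(* Squaring both nonnegative sides removes the root of p; then (S + B)^2 = (S - B)^2 + 4 S B reduces
   the claim to the product bound. *)
rewrite -(@ler_pXn2r _ 2) ?nnegrE ?ler0n ?divr_ge0 ?mulr_ge0 ?sqrtr_ge0 //.
rewrite expr_div_n !exprMn sqr_sqrtr ?ler0n //.
move: SB; rewrite expr_div_n natrM natrD => SB.
have := sqr_ge0 (S%:R - B%:R : R); nra.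
Qed.
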